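(* Let $K\ge1$ be a fixed constant. There is a one-pass streaming algorithm in the arbitrary order model using a heavy edge oracle $O_\rho$ (with threshold $\rho$ chosen by the algorithm) such that, if $O_\rho$ is a $K$-noisy oracle, then with probability $2/3$ the algorithm returns $\ell\in(1\pm\epsilon)T$, and it uses space at most $O\big(\epsilon^{-1}(m/\sqrt{T}+\sqrt{m})\big)$.
   Context: $G=(V,E)$ is a simple undirected graph with $n$ vertices, $m$ edges and $T$ triangles; $0<\epsilon<1$. Arbitrary order model: edges arrive one at a time in arbitrary order; one pass. For an edge $e=xy$, $N_e$ is the number of triangles containing both $x$ and $y$. For a threshold $\rho$, an oracle $O_\rho$ (outputting HEAVY or LIGHT on each queried edge) is $K$-noisy if for every edge $e$, $1-K\cdot\frac{\rho}{N_e}\le\Pr[O_\rho(e)=\textsc{heavy}]\le K\cdot\frac{N_e}{\rho}$. The algorithm is assumed to know a constant-factor approximation of $T$ for setting parameters. *)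

(* Defs.v *)
From HB Require Import structures.
From mathcomp Require Import all_boot all_order all_algebra.
From mathcomp Require Import reals.

Set Implicit Arguments.
Unset Strict Implicit.
Unset Printing Implicit Defensive.

Import Order.TTheory GRing.Theory Num.Theory.
Local Open Scope ring_scope.

Record sgraph (n : nat) := SGraph {
  adj :> rel 'I_n;
  adj_sym : symmetric adj;
  adj_irr : irreflexive adj }.

Definition edges n (G : sgraph n) : {set {set 'I_n}} :=
  [set e | [exists x, exists y, G x y && (e == [set x; y])]].

Definition triangles n (G : sgraph n) : {set {set 'I_n}} :=
  [set t : {set 'I_n} | (#|t| == 3%N) &&
    [forall x in t, forall y in t, (x != y) ==> G x y]].

Definition tri_count n (G : sgraph n) (e : {set 'I_n}) : nat :=
  #|[set t in triangles G | e \subset t]|.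

Definition edge_stream n (G : sgraph n) (s : seq {set 'I_n}) : bool :=
  perm_eq s (enum (edges G)).

Record fdist (R : realType) (A : finType) := FDist {
  fdist_val :> {ffun A -> R};
  fdist_ge0 : forall a, 0 <= fdist_val a;
  fdist_sum1 : \sum_a fdist_val a = 1 }.

Definition Pr (R : realType) (A : finType) (d : fdist R A) (P : pred A) : R :=
  \sum_(a | P a) d a.

(* A random oracle is a random labelling of the possible edges (true = HEAVY)
   with an arbitrary joint law; no independence between edges is assumed. *)
Definition labelling (n : nat) := {ffun {set 'I_n} -> bool}.

(* When tri_count G e = 0 the lower bound reads 1 - K * rho / 0, i.e. -oo, and
   is void; the guard is needed because x / 0 = 0 in MathComp. *)
Definition noisy (R : realType) n (G : sgraph n) (K rho : R)
    (D : fdist R (labelling n)) : Prop :=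
  forall e, e \in edges G ->
    let N := (tri_count G e)%:R : R in
    let h := Pr D (fun O : labelling n => O e) in
    (0 < N -> 1 - K * (rho / N) <= h) /\ h <= K * (N / rho).

(* S words of w bits. *)
Definition memory (S w : nat) := S.-tuple (w.-tuple bool).

(* The memory content is all that survives between two stream items: the coins
   used at each step are fresh, and must be stored if they are to be reused.
   A step sees the memory, the arriving edge and the oracle's answer on it. *)
Record stream_alg (R : realType) (n S w : nat) := StreamAlg {
  alg_init : fdist R (memory S w);
  alg_step : memory S w -> {set 'I_n} -> bool -> fdist R (memory S w);
  alg_out : memory S w -> R }.

(* Probability, for a fixed labelling O, that processing s from memory x
   produces an output satisfying P. *)
Fixpoint run_prob (R : realType) n S w (A : stream_alg R n S w)
    (O : labelling n) (P : pred R) (s : seq {set 'I_n}) (x : memory S w) : R :=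
  if s is e :: s' then
    \sum_y alg_step A x e (O e) y * run_prob A O P s' y
  else (P (alg_out A x))%:R.

(* The oracle is drawn from D independently of the coins of the algorithm. *)
Definition output_prob (R : realType) n S w (A : stream_alg R n S w)
    (D : fdist R (labelling n)) (s : seq {set 'I_n}) (P : pred R) : R :=
  \sum_O D O * \sum_x alg_init A x * run_prob A O P s x.

(* Main.v *)
Require Import Defs.
From HB Require Import structures.
From mathcomp Require Import all_boot all_order all_algebra.
From mathcomp Require Import reals.
From mathcomp Require Import zify ring lra.

Set Implicit Arguments.
Unset Strict Implicit.
Unset Printing Implicit Defensive.

Import Order.TTheory GRing.Theory Num.Theory.
Local Open Scope ring_scope.

(* Every edge declared heavy is stored, every light edge is stored with
   probability p, and a triangle is detected when its last edge arrives while
   the other two are stored; it then counts 1/p for each light one among them.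
   For a fixed oracle answer this estimate is unbiased, and two triangles are
   correlated only through a common light edge, so its variance is at most
   T / p^2 + (1 / p) * sum of N_e^2 over light edges e.  The lower noise bound
   gives N_e^2 Pr[e light] <= K rho N_e, and the N_e sum to 3 T, so on average
   over the oracle the variance is at most T / p^2 + 3 K rho T / p; the upper
   noise bound makes the expected storage at most 3 K T / rho + p m.  With rho
   of order eps T / sqrt m and p of order (1 / sqrt T + 1 / sqrt m) / eps,
   Chebyshev and Markov conclude.  To fit in a bounded memory, states are
   numbered: at most B stored edges of each kind, and an estimate
   a + b / p + c / p^2 with a, b, c <= n^3, make at most n^(12 (2 B + 1)) of
   them. *)

(** * Independent sampling and the variance of inverse-probability estimates *)

Section Sampling.
Variables (R : realType) (I : finType) (p : R).

(* The set J of sampled items contains each item independently with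
   probability p. *)
Definition sample_weight (J : {set I}) : R :=
  \prod_i (if i \in J then p else 1 - p).

Definition mean (f : {set I} -> R) : R := \sum_J sample_weight J * f J.

(** Expanding the product of two-term sums by distributivity gives one term for each possible
    sampled set. *)
Lemma mean_prod (g : I -> bool -> R) :
  mean (fun J => \prod_i g i (i \in J)) =
  \prod_i (p * g i true + (1 - p) * g i false).
Proof.
rewrite bigA_distr; apply: eq_bigr => J _; rewrite -big_split /=.
by apply: eq_bigr => i _; case: ifP.
Qed.

Lemma eq_mean f g : f =1 g -> mean f = mean g.
Proof. by move=> fg; apply: eq_bigr => J _; rewrite fg. Qed.

Lemma mean_cst (c : R) : mean (fun=> c) = c.
Proof.
have mean1 : mean (fun=> 1) = 1.
  transitivity (mean (fun J => \prod_(i : I) 1)).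
    by apply: eq_mean => J; rewrite big1.
  rewrite (mean_prod (fun _ _ => 1)) big1 // => i _.
  by rewrite !mulr1 addrC subrK.
rewrite -[RHS]mul1r -[in RHS]mean1 /mean mulr_suml.
by apply: eq_bigr => J _; rewrite mulr1.
Qed.

Lemma meanD f g : mean (fun J => f J + g J) = mean f + mean g.
Proof. by rewrite -big_split; apply: eq_bigr => J _; rewrite mulrDr. Qed.

Lemma meanZ c f : mean (fun J => c * f J) = c * mean f.
Proof. by rewrite mulr_sumr; apply: eq_bigr => J _; rewrite mulrCA. Qed.

Lemma mean_sum (X : finType) (P : pred X) (f : X -> {set I} -> R) :
  mean (fun J => \sum_(x | P x) f x J) = \sum_(x | P x) mean (f x).
Proof.
rewrite exchange_big /=; apply: eq_bigr => J _.
by rewrite mulr_sumr.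
Qed.

Lemma le_mean f g : 0 <= p <= 1 -> (forall J, f J <= g J) -> mean f <= mean g.
Proof.
move=> /andP[p0 p1] fg; apply: ler_sum => J _; apply: ler_wpM2l => //.
by apply: prodr_ge0 => i _; case: ifP; rewrite ?subr_ge0.
Qed.

Lemma big_setU1_split (i : I) (F : {set I} -> R) :
  \sum_J F J = \sum_(J : {set I} | i \notin J) (F (i |: J) + F J).
Proof.
rewrite (bigID (fun J : {set I} => i \in J)) /= big_split /=; congr (_ + _).
rewrite (reindex_onto (fun J => i |: J) (fun J => J :\ i)) /=; last first.
  by move=> J iJ; rewrite setD1K.
apply: eq_bigl => J; rewrite setU11 /=; apply/eqP/idP => [<-|iJ].
  by rewrite setD11.
by rewrite setU1K.
Qed.

(** The coin of [i] is independent of the others, so it can be drawn first; this peels one streaming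
    step off the joint sample. *)
Lemma mean_resample (i : I) (g : bool -> {set I} -> R) :
  (forall b J, g b (i |: J) = g b J) ->
  mean (fun J => g (i \in J) J) = p * mean (g true) + (1 - p) * mean (g false).
Proof.
move=> gi; rewrite -!meanZ -meanD /mean 2!(big_setU1_split i).
apply: eq_bigr => J iJ; rewrite !gi setU11 (negbTE iJ).
pose w := \prod_(j | j != i) (if j \in J then p else 1 - p).
have -> : sample_weight (i |: J) = p * w.
  rewrite /sample_weight (bigD1 i) //= setU11; congr (_ * _).
  by apply: eq_bigr => j ji; rewrite in_setU1 (negbTE ji).
have -> : sample_weight J = (1 - p) * w.
  by rewrite /sample_weight (bigD1 i) //= (negbTE iJ).
ring.
Qed.

Lemma mean_mem (i : I) : mean (fun J => (i \in J)%:R) = p.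
Proof.
rewrite (mean_resample (i := i) (g := fun b _ => b%:R)) // !mean_cst.
by rewrite mulr1 mulr0 addr0.
Qed.

(* Inverse-probability weight of an item: certain items always count 1, the
   others count 1 / p when sampled. *)
Definition ipw (certain : pred I) (J : {set I}) (i : I) : R :=
  if certain i then 1 else (i \in J)%:R / p.

(** Factors of different items are independent. An uncertain item in both sets has second moment
    [p * (1 / p) ^+ 2 = 1 / p]; every other factor has mean 1. *)
Lemma mean_prod_ipw (certain : pred I) (F F' : {set I}) : p != 0 ->
  mean (fun J => (\prod_(i in F) ipw certain J i) *
                 (\prod_(i in F') ipw certain J i)) =
  p^-1 ^+ #|[set i in F :&: F' | ~~ certain i]|.
Proof.
move=> p0.
pose h b i : R := if certain i then 1 else b%:R / p.
pose g i b := (if i \in F then h b i else 1) * (if i \in F' then h b i else 1).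
rewrite (eq_mean (g := fun J => \prod_i g i (i \in J))); last first.
  by move=> J; rewrite big_split /= -!big_mkcond.
rewrite (mean_prod g) -prodr_const [in RHS]big_mkcond /=; apply: eq_bigr => i _.
rewrite !inE /g /h; case: (i \in F); case: (i \in F'); case: (certain i) => //=;
  by field.
Qed.

(** Each product has mean 1, so the square expands into the covariances of all ordered pairs. *)
Lemma variance_ipw (X : finType) (D : {set X}) (certain : pred I)
    (F : X -> {set I}) : p != 0 ->
  mean (fun J => (\sum_(t in D) \prod_(i in F t) ipw certain J i - #|D|%:R) ^+ 2)
  = \sum_(t in D) \sum_(u in D)
      (p^-1 ^+ #|[set i in F t :&: F u | ~~ certain i]| - 1).
Proof.
move=> p0; pose Y J t := \prod_(i in F t) ipw certain J i.
have meanY t : mean (fun J => Y J t) = 1.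
  have := mean_prod_ipw certain (F t) set0 p0.
  rewrite setI0 (_ : [set i in set0 | _] = set0) ?cards0; last first.
    by apply/setP => i; rewrite !inE.
  by rewrite expr0 => <-; apply: eq_mean => J; rewrite big_set0 mulr1.
rewrite (eq_mean (g := fun J => \sum_(t in D) \sum_(u in D)
    (Y J t * Y J u + ((-1) * Y J t + ((-1) * Y J u + 1))))); last first.
  move=> J; rewrite -sumr_const -sumrB expr2 mulr_suml; apply: eq_bigr => t _.
  by rewrite mulr_sumr; apply: eq_bigr => u _; rewrite -/(Y J t) -/(Y J u); ring.
rewrite mean_sum; apply: eq_bigr => t _; rewrite mean_sum; apply: eq_bigr => u _.
rewrite !meanD !meanZ !meanY mean_prod_ipw // mean_cst; ring.
Qed.

Lemma variance_ipw_le (X : finType) (D : {set X}) (certain : pred I)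
    (F : X -> {set I}) : 0 < p <= 1 ->
  (forall t, t \in D -> (#|F t| <= 2)%N) ->
  (forall t u, t \in D -> u \in D -> t != u -> (#|F t :&: F u| <= 1)%N) ->
  mean (fun J => (\sum_(t in D) \prod_(i in F t) ipw certain J i - #|D|%:R) ^+ 2)
  <= #|D|%:R / p ^+ 2 +
     p^-1 * \sum_(i | ~~ certain i) #|[set t in D | i \in F t]|%:R ^+ 2.
Proof.
move=> /andP[p0 p1] F2 F1; rewrite variance_ipw ?gt_eqF //.
have r1 : 1 <= p^-1 by rewrite invf_ge1.
pose k t u := #|[set i in F t :&: F u | ~~ certain i]|.
(* Double counting: both sides count the triples of an uncertain item and an ordered pair of members
   of [D] containing it. *)
have -> : \sum_(i | ~~ certain i) #|[set t in D | i \in F t]|%:R ^+ 2 =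
    \sum_(t in D) \sum_(u in D) (k t u)%:R :> R.
  transitivity (\sum_(i | ~~ certain i) \sum_t \sum_u
      (t \in [set t in D | i \in F t])%:R *
      (u \in [set t in D | i \in F t])%:R : R).
    apply: eq_bigr => i _; rewrite expr2 -sum1_card natr_sum big_mkcond mulr_suml.
    apply: eq_bigr => t _; rewrite mulr_sumr; apply: eq_bigr => u _.
    by congr (_ * _); case: ifP.
  rewrite exchange_big [RHS]big_mkcond /=; apply: eq_bigr => t _.
  rewrite exchange_big /=.
  case: ifP => tD; last first.
    by rewrite !big1 // => u _; rewrite big1 // => i _; rewrite inE tD mul0r.
  rewrite [RHS]big_mkcond /=; apply: eq_bigr => u _.
  case: ifP => uD; last first.
    by rewrite big1 // => i _; rewrite !inE uD mulr0.
  rewrite /k -sum1_card natr_sum big_mkcond [RHS]big_mkcond /=.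
  apply: eq_bigr => i _; rewrite !inE tD uD /=.
  by case: (certain i); case: (i \in F t); case: (i \in F u);
     rewrite /= ?mul0r ?mulr0 ?mulr1.
(* Placing this term on the diagonal pairs lets the two sides be compared pair by pair. *)
have -> : #|D|%:R / p ^+ 2 = \sum_(t in D) \sum_(u in D) (t == u)%:R * p^-1 ^+ 2.
  rewrite -sumr_const mulr_suml; apply: eq_bigr => t tD.
  rewrite (bigD1 t) //= eqxx big1 => [|u /andP[_ /negbTE ut]].
    by rewrite addr0 exprVn.
  by rewrite eq_sym ut mul0r.
rewrite mulr_sumr -big_split; apply: ler_sum => t tD /=.
rewrite mulr_sumr -big_split; apply: ler_sum => u uD /=.
have kle : (k t u <= #|F t :&: F u|)%N.
  by apply: subset_leq_card; apply/subsetP => i; rewrite !inE => /andP[].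
rewrite -/(k t u); have [tu|tu] := eqVneq t u.
  have k2 : (k t u <= 2)%N.
    by apply: leq_trans kle _; rewrite -tu setIid F2.
  rewrite mul1r lerD //; first by apply: ler_weXn2l.
  by rewrite (@le_trans _ _ 0) ?oppr_le0 // mulr_ge0 // invr_ge0 ltW.
(* Off the diagonal the covariance is 0 when no uncertain item is shared, and [p^-1 - 1] when one
   is. *)
have k1 : (k t u <= 1)%N by apply: leq_trans kle _; apply: F1.
case: (k t u) k1 => [|[|//]] _; first by rewrite expr0 subrr mul0r mulr0 addr0.
by rewrite expr1 mul0r add0r mulr1 gerBl.
Qed.

End Sampling.

(** * Streaming algorithms that toss one coin per edge *)

Section CoinAlgorithms.
Variables (R : realType) (p : R) (hp : 0 <= p <= 1).

Section Coin.
Variables (A : finType) (a b : A).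

Let coin_val : {ffun A -> R} :=
  [ffun y => p * (y == a)%:R + (1 - p) * (y == b)%:R].

Lemma sum_coin_val (f : A -> R) :
  \sum_y coin_val y * f y = p * f a + (1 - p) * f b.
Proof.
transitivity (\sum_y ((if y == a then p * f y else 0) +
                      (if y == b then (1 - p) * f y else 0))).
  apply: eq_bigr => y _; rewrite ffunE mulrDl.
  by case: eqP; case: eqP; rewrite ?mulr1 ?mulr0 ?mul0r.
by rewrite big_split -!big_mkcond !big_pred1_eq.
Qed.

Lemma coin_val_ge0 y : 0 <= coin_val y.
Proof.
move: hp => /andP[p0 p1].
by rewrite ffunE addr_ge0 // mulr_ge0 // subr_ge0.
Qed.

Lemma coin_val_sum1 : \sum_y coin_val y = 1.
Proof.
under eq_bigr do rewrite -[coin_val _]mulr1.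
by rewrite (sum_coin_val (fun=> 1)) !mulr1 addrC subrK.
Qed.

Definition coin : fdist R A := FDist coin_val_ge0 coin_val_sum1.

Lemma sum_coin (f : A -> R) : \sum_y coin y * f y = p * f a + (1 - p) * f b.
Proof. exact: sum_coin_val. Qed.

End Coin.

Variables (n S w : nat).
Variables (init : memory S w)
  (next : memory S w -> {set 'I_n} -> bool -> bool -> memory S w)
  (out : memory S w -> R).

(** Both sides of the initial coin agree, so the initial memory is deterministic. *)
Definition coin_alg : stream_alg R n S w :=
  StreamAlg (coin init init)
    (fun x e h => coin (next x e h true) (next x e h false)) out.

Definition coin_run (O : labelling n) (J : {set {set 'I_n}}) x s :=
  foldl (fun x e => next x e (O e) (e \in J)) x s.

Lemma coin_run_setU1 O J e s x : e \notin s ->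
  coin_run O (e |: J) x s = coin_run O J x s.
Proof.
elim: s x => //= f s IHs x; rewrite in_cons negb_or => /andP[ef es].
by rewrite in_setU1 eq_sym (negbTE ef) IHs.
Qed.

(* Each edge arrives once, so the fresh coins of the steps form one random set
   of edges drawn in advance. *)
Lemma run_prob_coin_alg O (P : pred R) s x : uniq s ->
  run_prob coin_alg O P s x = mean p (fun J => (P (out (coin_run O J x s)))%:R).
Proof.
elim: s x => [|e s IHs] x /=; first by rewrite mean_cst.
move=> /andP[es us].
rewrite (sum_coin _ _ (run_prob coin_alg O P s)) !IHs //.
rewrite (mean_resample p (i := e)
  (g := fun b J => (P (out (coin_run O J (next x e (O e) b) s)))%:R)) //.
by move=> b J; rewrite coin_run_setU1.
Qed.

Lemma output_prob_coin_alg (D : fdist R (labelling n)) s P : uniq s ->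
  output_prob coin_alg D s P =
  \sum_O D O * mean p (fun J => (P (out (coin_run O J init s)))%:R).
Proof.
move=> us; apply: eq_bigr => O _; rewrite (sum_coin _ _ (run_prob _ _ _ _)).
by rewrite run_prob_coin_alg // -mulrDl addrC subrK mul1r.
Qed.

End CoinAlgorithms.

(** * Counting triangles and their edges; arrival order within a triangle *)

Section Triangles.
Variable n : nat.
Implicit Types (e f t u : {set 'I_n}) (s : seq {set 'I_n}) (G : sgraph n).

Definition tri_edges t : {set {set 'I_n}} :=
  [set f : {set 'I_n} | f \subset t & #|f| == 2%N].

Lemma card_tri_edges t : #|t| = 3%N -> #|tri_edges t| = 3%N.
Proof. by move=> t3; rewrite cards_draws t3. Qed.

(** Distinct triples share at most two vertices, hence at most one pair. *)
Lemma card_tri_edgesI t u : #|t| = 3%N -> #|u| = 3%N -> t != u ->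
  (#|tri_edges t :&: tri_edges u| <= 1)%N.
Proof.
move=> t3 u3 tu.
have -> : tri_edges t :&: tri_edges u =
    [set f : {set 'I_n} | f \subset t :&: u & #|f| == 2%N].
  by apply/setP => f; rewrite !inE subsetI andbACA andbb.
rewrite cards_draws.
have lt3 : (#|t :&: u| < 3)%N.
  rewrite ltnNge; apply: contra tu => ge3; rewrite eqEcard t3 u3 leqnn andbT.
  suff <- : t :&: u = t by apply: subsetIr.
  by apply/eqP; rewrite eqEcard subsetIl t3.
by case: #|_| lt3 => [|[|[|]]].
Qed.

Lemma edgesP G e :
  reflect (exists x y, G x y /\ e = [set x; y]) (e \in edges G).
Proof.
rewrite inE; apply: (iffP existsP) => [[x /existsP[y /andP[xy /eqP->]]]|].
  by exists x, y.
by move=> [x [y [xy ->]]]; exists x; apply/existsP; exists y; rewrite xy eqxx.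
Qed.

Lemma card_edge G e : e \in edges G -> #|e| = 2%N.
Proof.
move=> /edgesP[x [y [xy ->]]]; rewrite cards2.
by case: eqP xy => // ->; rewrite adj_irr.
Qed.

Lemma card_triangle G t : t \in triangles G -> #|t| = 3%N.
Proof. by rewrite inE => /andP[/eqP]. Qed.

Lemma mem_triangles G t :
  (t \in triangles G) = (#|t| == 3%N) && (tri_edges t \subset edges G).
Proof.
rewrite inE; case: eqP => //= t3.
apply/forall_inP/subsetP => [tG f|tG x xt].
  rewrite inE => /andP[/subsetP ft /cards2P[x [y [xy fE]]]].
  apply/edgesP; exists x, y; split=> //.
  have xt : x \in t by apply: ft; rewrite fE set21.
  have yt : y \in t by apply: ft; rewrite fE set22.
  by have /forall_inP/(_ y yt)/implyP := tG x xt; apply.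
apply/forall_inP => y yt; apply/implyP => xy.
have /edgesP[x' [y' [xy' /setP E]]] : [set x; y] \in edges G.
  by apply: tG; rewrite inE cards2 xy subUset !sub1set xt yt.
have := E x; have := E y; rewrite !inE !eqxx ?orbT ?orTb /=.
move=> /esym/orP[]/eqP ? /esym/orP[]/eqP ?; subst; rewrite ?eqxx // in xy *.
by rewrite adj_sym.
Qed.

Lemma card_triangles G : (#|triangles G| <= n ^ 3)%N.
Proof.
have lt : (#|triangles G| <= #|[set t : {set 'I_n} | #|t| == 3%N]|)%N.
  by apply: subset_leq_card; apply/subsetP => t; rewrite !inE => /andP[].
apply: leq_trans lt _; rewrite card_draws card_ord.
rewrite bin_ffactd; apply: leq_trans (leq_div _ _) _.
by rewrite !ffactnS ffactn0 /=; nia.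
Qed.

(** Double counting: a triangle is counted once for each of its three edges. *)
Lemma sum_tri_count G :
  (\sum_(e in edges G) tri_count G e <= 3 * #|triangles G|)%N.
Proof.
under eq_bigr do rewrite /tri_count -sum1_card big_mkcond.
rewrite exchange_big mulnC -sum_nat_const [leqRHS]big_mkcond /=.
apply: leq_sum => t _.
case: ifP => tG; last by rewrite big1 // => e _; rewrite inE tG.
rewrite -(card_tri_edges (card_triangle tG)) -sum1_card.
rewrite big_mkcond [leqRHS]big_mkcond; apply: leq_sum => e _.
case: ifP => // /card_edge/eqP e2; rewrite !inE e2 andbT.
by case: (e \subset t); rewrite ?andbF // andbT; case: ifP.
Qed.

(* The edges of t other than the one that arrives last in s. *)
Definition early_edges s t : {set {set 'I_n}} :=
  [set f in tri_edges t | [exists g in tri_edges t, (index f s < index g s)%N]].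

Lemma early_edges_sub s t : early_edges s t \subset tri_edges t.
Proof. by apply/subsetP => f; rewrite inE => /andP[]. Qed.

(** The pair of largest index in [s] is not early. *)
Lemma card_early_edges s t : #|t| = 3%N -> (#|early_edges s t| <= 2)%N.
Proof.
move=> t3; rewrite -ltnS -(card_tri_edges t3); apply: proper_card.
rewrite properE early_edges_sub /=; apply/subsetPn.
have /card_gt0P[f0 f0t] : (0 < #|tri_edges t|)%N by rewrite card_tri_edges.
case: (arg_maxnP (fun f => index f s) f0t) => f ft fmax; exists f => //.
rewrite [f \in _]inE (ft : f \in tri_edges t) /=; apply/exists_inP => -[g gt].
by rewrite ltnNge; apply/negP; rewrite negbK; exact: (fmax g gt).
Qed.

(** Identifies the edges inspected when [e] closes [t] with a set that depends only on the whole
    stream. *)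
Lemma early_edges_last s1 s2 e t : e \notin s1 -> e \in tri_edges t ->
  {subset tri_edges t :\ e <= s1} ->
  early_edges (s1 ++ e :: s2) t = tri_edges t :\ e.
Proof.
move=> es1 et ts1.
have ie : index e (s1 ++ e :: s2) = size s1.
  by rewrite index_cat (negbTE es1) /= eqxx addn0.
have ilt f : f \in tri_edges t -> f != e -> (index f (s1 ++ e :: s2) < size s1)%N.
  move=> ft fe; have fs1 : f \in s1 by apply: ts1; rewrite inE in_set1 fe.
  by rewrite index_cat fs1 index_mem.
apply/setP => f; rewrite in_setD1 [LHS]inE andbC; case: (boolP (f \in _)) => // ft.
  have [->|fe] := eqVneq f e; last first.
    by rewrite !andbT; apply/exists_inP; exists e; rewrite // ie ilt.
  rewrite /= !andbT; apply/negbTE/exists_inP => -[g gt]; rewrite ie ltnNge.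
  by have [->|ge] := eqVneq g e; rewrite ?ie ?leqnn // ltnW // ilt.
by rewrite !andbF.
Qed.

End Triangles.

(** * The estimator and its closed form *)

Section Estimator.
Variables (R : realType) (n : nat) (p : R).
Implicit Types (e f t : {set 'I_n}) (s : seq {set 'I_n}).

(* Stored heavy edges, stored light edges, current estimate. *)
Definition state := ({set {set 'I_n}} * {set {set 'I_n}} * R)%type.

Definition state0 : state := (set0, set0, 0).

(** In the states reached by a run the two stored sets are disjoint, so the sum is 1 for a stored
    heavy edge, [1 / p] for a stored light one and 0 otherwise. *)
Definition stored_weight (st : state) f : R :=
  (f \in st.1.1)%:R + (f \in st.1.2)%:R / p.

(** All vertex triples through [e] may be summed without knowing the graph: one with an unstored
    other side contributes 0. *)
Definition closing_weight (st : state) e : R :=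
  \sum_(t : {set 'I_n} | (#|t| == 3%N) && (e \in tri_edges t))
    \prod_(f in tri_edges t :\ e) stored_weight st f.

Definition next_state (st : state) e (heavy sampled : bool) : state :=
  (if heavy then e |: st.1.1 else st.1.1,
   if ~~ heavy && sampled then e |: st.1.2 else st.1.2,
   st.2 + closing_weight st e).

Definition state_after (O : labelling n) (J : {set {set 'I_n}}) s : state :=
  foldl (fun st e => next_state st e (O e) (e \in J)) state0 s.

Section Run.
Variables (G : sgraph n) (O : labelling n) (J : {set {set 'I_n}}).

Lemma stored_after s :
  (state_after O J s).1 =
  ([set e in s | O e], [set e in s | ~~ O e && (e \in J)]).
Proof.
elim/last_ind: s => [|s e IHs].
  by congr (_, _); apply/setP => e; rewrite !inE.
rewrite /state_after foldl_rcons -/(state_after _ _ _) /next_state /= IHs /=.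
congr (_, _); apply/setP => f.
  case: ifP => Oe; rewrite !inE mem_rcons in_cons; case: eqP => //= ->;
  by rewrite Oe ?andbF.
case: ifP => Oe; rewrite !inE mem_rcons in_cons; case: eqP => //= ->;
by rewrite Oe ?andbF.
Qed.

Lemma stored_weight_after s f :
  stored_weight (state_after O J s) f = if f \in s then ipw p O J f else 0.
Proof.
rewrite /stored_weight stored_after /ipw /= !inE.
by case: (f \in s); case: (O f); case: (f \in J);
  rewrite /= ?mul0r ?addr0 ?add0r.
Qed.

(** Induction on the prefix; the suffix [s2] stays general so that early edges always refer to the
    full stream. *)
Lemma estimate_after s1 s2 : uniq (s1 ++ s2) -> {subset s1 <= edges G} ->
  (state_after O J s1).2 =
  \sum_(t in triangles G | tri_edges t \subset s1)
    \prod_(f in early_edges (s1 ++ s2) t) ipw p O J f.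
Proof.
elim/last_ind: s1 s2 => [|s1 e IHs] s2.
  rewrite big1 // => t /andP[/card_triangle/card_tri_edges t3 /subset_leq_card].
  by rewrite t3 card0.
rewrite cat_rcons => us sG.
have [es1 eG] : e \notin s1 /\ e \in edges G.
  split; last by apply: sG; rewrite mem_rcons mem_head.
  move: us; rewrite cat_uniq => /and3P[_ /hasPn H _].
  by apply: H; rewrite mem_head.
have s1G : {subset s1 <= edges G}.
  by move=> f fs; apply: sG; rewrite mem_rcons in_cons fs orbT.
rewrite /state_after foldl_rcons -/(state_after _ _ _) /next_state /=.
(* Triangles through [e] are those closed just now; the others were complete before. *)
rewrite (IHs (e :: s2)) // addrC [RHS](bigID (fun t => e \in tri_edges t)) /=.
congr (_ + _); last first.
  apply: eq_bigl => t; rewrite -andbA; congr (_ && _).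
  apply/subsetP/andP => [ts|[/subsetP ts et] f ft].
    split; last by apply: contra es1 => /ts.
    by apply/subsetP => f /ts; rewrite mem_rcons in_cons => ->; rewrite orbT.
  move: (ts f ft); rewrite mem_rcons in_cons => /predU1P[fe|//].
  by rewrite -fe ft in et.
rewrite /closing_weight big_mkcond [RHS]big_mkcond; apply: eq_bigr => t _ /=.
case: (boolP (e \in tri_edges t)) => et; rewrite ?andbF ?andbT //.
under eq_bigr do rewrite stored_weight_after.
(* If another side of [t] has not arrived, its stored weight is 0 and [t] is not yet complete, so
   both contributions vanish. *)
case: (boolP (tri_edges t :\ e \subset s1)) => [/subsetP ts1|]; last first.
  move=> /subsetPn[f fte fs1]; rewrite (bigD1 f) //= (negbTE fs1) mul0r if_same.
  case: ifP => // /andP[_ /subsetP/(_ f)]; move: fte.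
  rewrite in_setD1 => /andP[fe ->] /(_ isT).
  by rewrite mem_rcons in_cons (negbTE fe) (negbTE fs1).
have tsub : tri_edges t \subset rcons s1 e.
  apply/subsetP => f ft; rewrite mem_rcons in_cons.
  by have [//|fe] := eqVneq f e; rewrite ts1 // in_setD1 fe.
have tG : tri_edges t \subset edges G.
  by apply: subset_trans tsub _; apply/subsetP.
rewrite mem_triangles tG tsub !andbT early_edges_last //.
by case: ifP => // _; apply: eq_bigr => f /ts1 ->.
Qed.

Lemma estimate_final s : edge_stream G s ->
  (state_after O J s).2 =
  \sum_(t in triangles G) \prod_(f in early_edges s t) ipw p O J f.
Proof.
move=> sG; have us : uniq s by rewrite (perm_uniq sG) enum_uniq.
have sE f : (f \in s) = (f \in edges G) by rewrite (perm_mem sG) mem_enum.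
have := @estimate_after s [::]; rewrite cats0 => -> //; last first.
  by move=> f; rewrite sE.
apply: eq_bigl => t; case tG : (t \in triangles G) => //=.
apply/subsetP => f ft; rewrite sE; move: tG; rewrite mem_triangles.
by move=> /andP[_ /subsetP]; apply.
Qed.

End Run.

(** * Numbering the states by memory contents *)

Variables (S w B : nat).

Definition small_edge_sets : {set {set {set 'I_n}}} :=
  [set A : {set {set 'I_n}} |
    (A \subset [set e : {set 'I_n} | #|e| == 2%N]) && (#|A| <= B)%N].

(** The three counters tally triangles detected with zero, one and two light early edges. *)
Definition estimates : seq R :=
  [seq x.1.1%:R + x.1.2%:R / p + x.2%:R / p ^+ 2 |
    x <- allpairs pair (allpairs pair (iota 0 (n ^ 3).+1) (iota 0 (n ^ 3).+1))
                       (iota 0 (n ^ 3).+1)].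

Definition states : seq state :=
  allpairs pair (allpairs pair (enum small_edge_sets) (enum small_edge_sets))
                estimates.

(** A set of at most [B] pairs is the content of [B] slots, each holding a pair or [None]. *)
Lemma card_small_edge_sets :
  (#|small_edge_sets| <= ('C(n, 2)).+1 ^ B)%N.
Proof.
pose E := [set e : {set 'I_n} | #|e| == 2%N].
pose W := [set x : option {set 'I_n} | if x is Some e then e \in E else true].
have cW : #|W| = ('C(n, 2)).+1.
  have -> : W = None |: [set Some e | e in E].
    apply/setP => -[e|]; rewrite !inE //=; apply/idP/imsetP => [eE|[f fE [->]]].
      by exists e; rewrite // inE.
    by rewrite inE in fE.
  rewrite cardsU1 card_imset; last by move=> ? ? [].
  rewrite card_draws card_ord; case: imsetP => [[? _]//|_].
  by rewrite add1n.
pose g (x : {ffun 'I_B -> option {set 'I_n}}) :=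
  [set e : {set 'I_n} | Some e \in codom x].
have sub : small_edge_sets \subset g @: [set x in ffun_on (mem W)].
  apply/subsetP => A; rewrite inE => /andP[/subsetP AE AB].
  (* The elements of [A] fill the first slots; the default of [nth] leaves the rest empty. *)
  apply/imsetP; exists [ffun i : 'I_B => nth None (map Some (enum A)) i].
    rewrite inE; apply/ffun_onP => i; rewrite ffunE.
    have [lt|ge] := ltnP i (size (map Some (enum A))); last first.
      by rewrite nth_default // inE.
    have /mapP[e eA ->] := mem_nth None lt.
    by rewrite mem_enum in eA; rewrite inE AE.
  apply/setP => e; rewrite inE; apply/idP/codomP => [eA|[i]].
    have iA : (index e (enum A) < size (enum A))%N by rewrite index_mem mem_enum.
    have iB : (index e (enum A) < B)%N by apply: leq_trans iA _; rewrite -cardE.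
    exists (Ordinal iB); rewrite ffunE /= (nth_map set0) // nth_index //.
    by rewrite mem_enum.
  rewrite ffunE; have [lt|ge] := ltnP i (size (map Some (enum A))); last first.
    by rewrite nth_default.
  by move=> eE; have := mem_nth None lt; rewrite -eE => /mapP[f fA [->]];
    rewrite mem_enum in fA.
apply: leq_trans (subset_leq_card sub) _; apply: leq_trans (leq_imset_card _ _) _.
by rewrite cardsE card_ffun_on cW card_ord.
Qed.

(** The two edge sets cost [n ^ (4 * B)] and the counters [n ^ 12]; the exponent is rounded up so
    that [2 * B + 1] equal words suffice. *)
Lemma size_states : (1 < n)%N -> (size states <= n ^ (12 * (2 * B + 1)))%N.
Proof.
move=> n1; rewrite !size_allpairs size_map !size_allpairs size_iota -cardE.
have cE : (#|small_edge_sets| <= n ^ (2 * B))%N.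
  rewrite expnM; apply: leq_trans card_small_edge_sets _.
  have [->//|B0] := posnP B; rewrite leq_exp2r //.
  have := bin_ffact n 2; rewrite !ffactnS ffactn0 /= muln1 (_ : 2`! = 2)%N //.
  by rewrite -mulnn; nia.
have cN : ((n ^ 3).+1 <= n ^ 4)%N.
  have : (0 < n ^ 3)%N by rewrite expn_gt0 (ltnW n1).
  by rewrite (expnS n 3); nia.
apply: leq_trans (leq_mul (leq_mul cE cE) (leq_mul (leq_mul cN cN) cN)) _.
by rewrite -!expnD leq_exp2l //; lia.
Qed.

(** A state outside [states] gets an arbitrary content; such overflows are charged to the failure
    probability. *)
Definition encode (x : state) : memory S w :=
  nth [tuple of nseq S [tuple of nseq w false]] (enum {: memory S w})
    (index x states).

Definition decode (y : memory S w) : state :=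
  nth state0 states (index y (enum {: memory S w})).

Lemma encodeK : (size states <= 2 ^ (w * S))%N ->
  {in states, cancel encode decode}.
Proof.
move=> le x xs; rewrite /decode /encode index_uniq ?enum_uniq ?nth_index //.
rewrite -cardE !card_tuple card_bool -expnM.
by apply: leq_trans le; rewrite index_mem.
Qed.

Lemma sum_mem_estimates (X : finType) (D : {set X}) (F : X -> R) :
  (#|D| <= n ^ 3)%N ->
  (forall x, x \in D -> F x = 0 \/ exists2 k, (k <= 2)%N & F x = p^-1 ^+ k) ->
  \sum_(x in D) F x \in estimates.
Proof.
move=> D3 DF.
(* Each nonzero term increments the counter of its exponent [k]; zero terms increment none, hence
   only an inequality. *)
suff [a [b [c [abc ->]]]] : exists a b c, (a + b + c <= #|D|)%N /\
    \sum_(x in D) F x = a%:R + b%:R / p + c%:R / p ^+ 2.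
  apply/mapP; exists (a, b, c) => //.
  by do 2?[apply: allpairs_f]; rewrite mem_iota; lia.
have {}DF x : x \in enum D ->
    F x = 0 \/ exists2 k, (k <= 2)%N & F x = p^-1 ^+ k.
  by rewrite mem_enum; apply: DF.
rewrite -big_enum cardE; elim: (enum D) DF => [|x l IHl] DF.
  by exists 0%N, 0%N, 0%N; rewrite big_nil; split=> //; rewrite !mul0r !addr0.
have [|a [b [c [abc E]]]] := IHl.
  by move=> y yl; apply: DF; rewrite in_cons yl orbT.
rewrite big_cons E /=; case: (DF x (mem_head _ _)) => [->|[k k2 ->]].
  by exists a, b, c; split=> /=; [lia|rewrite add0r].
case: k k2 => [|[|[|//]]] _.
- by exists a.+1, b, c; split=> /=; [lia|rewrite expr0 -natr1; ring].
- by exists a, b.+1, c; split=> /=; [lia|rewrite expr1 -natr1; ring].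
- by exists a, b, c.+1; split=> /=; [lia|rewrite -natr1 exprVn; ring].
Qed.

Lemma prod_ipw_cases (O : labelling n) J (F : {set {set 'I_n}}) :
  (#|F| <= 2)%N ->
  \prod_(f in F) ipw p O J f = 0 \/
  exists2 k, (k <= 2)%N & \prod_(f in F) ipw p O J f = p^-1 ^+ k.
Proof.
move=> F2.
suff [->|[k kF ->]] : \prod_(f in F) ipw p O J f = 0 \/
    exists2 k, (k <= #|F|)%N & \prod_(f in F) ipw p O J f = p^-1 ^+ k.
- by left.
- by right; exists k => //; apply: leq_trans F2.
rewrite -big_enum cardE; elim: (enum F) => [|f l [IHl|[k kl IHl]]].
- by right; exists 0%N; rewrite // big_nil.
- by left; rewrite big_cons IHl /= mulr0.
rewrite big_cons IHl /ipw /=; case: (O f); last case: (f \in J).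
- by right; exists k; rewrite ?mul1r //= ltnW.
- by right; exists k.+1; rewrite // exprS mul1r.
- by left; rewrite !mul0r.
Qed.

Lemma state_after_mem (G : sgraph n) (O : labelling n) (J : {set {set 'I_n}}) s1 s2 :
  uniq (s1 ++ s2) -> {subset s1 <= edges G} ->
  (#|[set e in s1 | O e]| <= B)%N ->
  (#|[set e in s1 | ~~ O e && (e \in J)]| <= B)%N ->
  state_after O J s1 \in states.
Proof.
move=> us sG cH cL; rewrite [state_after _ _ _]surjective_pairing stored_after.
have sE P : [set e in s1 | P e] \subset [set e : {set 'I_n} | #|e| == 2%N].
  by apply/subsetP => e; rewrite !inE => /andP[/sG/card_edge-> _].
apply: allpairs_f.
  by apply: allpairs_f; rewrite mem_enum inE sE.
rewrite (estimate_after O J us sG).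
rewrite -(eq_bigl _ _ (in_set _)); apply: sum_mem_estimates => [|t].
  apply: leq_trans (card_triangles G); apply: subset_leq_card.
  by apply/subsetP => t; rewrite inE => /andP[].
rewrite inE => /andP[/card_triangle t3 _].
exact/prod_ipw_cases/card_early_edges.
Qed.

Definition next_memory (y : memory S w) e (heavy sampled : bool) :=
  encode (next_state (decode y) e heavy sampled).

(** Stored sets only grow, so the bounds on the full stream hold at every prefix and no intermediate
    state leaves [states]. *)
Lemma memory_run (G : sgraph n) (O : labelling n) (J : {set {set 'I_n}}) s :
  edge_stream G s ->
  (size states <= 2 ^ (w * S))%N ->
  (#|[set e in s | O e]| <= B)%N ->
  (#|[set e in s | ~~ O e && (e \in J)]| <= B)%N ->
  decode (coin_run next_memory O J (encode state0) s) = state_after O J s.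
Proof.
move=> sG le cH cL; have us : uniq s by rewrite (perm_uniq sG) enum_uniq.
have sE f : f \in s -> f \in edges G by rewrite (perm_mem sG) mem_enum.
have good s1 s2 : s = s1 ++ s2 -> state_after O J s1 \in states.
  move=> E; apply: (@state_after_mem G O J s1 s2); rewrite -?E //.
  - by move=> f f1; apply: sE; rewrite E mem_cat f1.
  - apply: leq_trans cH; apply: subset_leq_card; apply/subsetP => f.
    by rewrite !inE E mem_cat => /andP[-> ->].
  - apply: leq_trans cL; apply: subset_leq_card; apply/subsetP => f.
    by rewrite !inE E mem_cat => /andP[-> ->].
suff H s1 s2 : s = s1 ++ s2 ->
    coin_run next_memory O J (encode state0) s1 = encode (state_after O J s1).
  have := H s [::]; rewrite cats0 => -> //.
  by rewrite encodeK //; apply: (good s [::]); rewrite cats0.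
elim/last_ind: s1 s2 => [//|s1 e IHs] s2; rewrite cat_rcons => E.
rewrite /coin_run foldl_rcons -/(coin_run _ _ _ _ _) (IHs _ E) /next_memory.
rewrite encodeK ?(good _ _ E) //; congr encode.
by rewrite /state_after foldl_rcons.
Qed.

Definition triangle_alg (hp : 0 <= p <= 1) : stream_alg R n S w :=
  coin_alg hp (encode state0) next_memory (fun y => (decode y).2).

End Estimator.

(** * Expected error and storage under a noisy oracle *)

Section Accuracy.
Variables (R : realType) (n : nat) (G : sgraph n) (K rho p : R).
Variables (D : fdist R (labelling n)) (s : seq {set 'I_n}).
Hypotheses (K_ge0 : 0 <= K) (rho_gt0 : 0 < rho) (p01 : 0 < p <= 1).
Hypotheses (sG : edge_stream G s) (noisyD : noisy G K rho D).

Let T : R := #|triangles G|%:R.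
Let m : R := #|edges G|%:R.

Lemma stream_uniq : uniq s.
Proof. by rewrite (perm_uniq sG) enum_uniq. Qed.

Lemma mem_stream f : (f \in s) = (f \in edges G).
Proof. by rewrite (perm_mem sG) mem_enum. Qed.

Lemma PrE (P : pred (labelling n)) : Pr D P = \sum_O D O * (P O)%:R.
Proof.
rewrite /Pr big_mkcond; apply: eq_bigr => O _.
by case: ifP; rewrite ?mulr1 ?mulr0.
Qed.

Lemma Pr_light e : \sum_O D O * (~~ O e)%:R = 1 - Pr D (fun O => O e).
Proof.
rewrite PrE -[X in X - _](fdist_sum1 D) -sumrB; apply: eq_bigr => O _.
by case: (O e); rewrite /= ?mulr1 ?mulr0 ?subrr ?subr0.
Qed.

Lemma sum_tri_count_le : \sum_(e in edges G) (tri_count G e)%:R <= 3 * T :> R.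
Proof. by rewrite -natr_sum -natrM ler_nat sum_tri_count. Qed.

Definition sq_error (O : labelling n) (J : {set {set 'I_n}}) : R :=
  ((state_after p O J s).2 - T) ^+ 2.

Definition storage (O : labelling n) (J : {set {set 'I_n}}) : nat :=
  (#|[set e in s | O e]| + #|[set e in s | ~~ O e && (e \in J)]|)%N.

Lemma sq_errorE (O : labelling n) J : sq_error O J =
  (\sum_(t in triangles G) \prod_(f in early_edges s t) ipw p O J f - T) ^+ 2.
Proof. by rewrite /sq_error (estimate_final _ _ _ sG). Qed.

(** Covers a sampling probability capped at 1, where the general bound would still leave a term
    [T]. *)
Lemma mean_sq_error_exact (O : labelling n) : p = 1 -> mean p (sq_error O) = 0.
Proof.
move=> p1; rewrite (eq_mean p (sq_errorE O)).
rewrite variance_ipw ?gt_eqF //; last by case/andP: p01.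
by rewrite big1 // => t _; rewrite big1 // => u _; rewrite p1 invr1 expr1n subrr.
Qed.

(** Only light edges are uncertain, and the triangles in which [e] is early are among those
    containing it. *)
Lemma mean_sq_error (O : labelling n) :
  mean p (sq_error O) <= T / p ^+ 2 +
    p^-1 * \sum_(e in edges G) (tri_count G e)%:R ^+ 2 * (~~ O e)%:R.
Proof.
rewrite (eq_mean p (sq_errorE O)).
apply: (le_trans (variance_ipw_le _ _ _ _)) => //.
- by move=> t /card_triangle; apply: card_early_edges.
- move=> t u /card_triangle t3 /card_triangle u3 tu.
  apply: leq_trans (card_tri_edgesI t3 u3 tu); apply: subset_leq_card.
  by apply: setISS; apply: early_edges_sub.
rewrite lerD2l ler_wpM2l //; first by rewrite invr_ge0 ltW //; case/andP: p01.
rewrite big_mkcond [leRHS]big_mkcond /=; apply: ler_sum => e _.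
case: (O e) => /=; first by rewrite mulr0 if_same.
case: ifP => eG; rewrite ?mulr1.
  rewrite lerXn2r ?nnegrE // ler_nat; apply: subset_leq_card.
  apply/subsetP => t; rewrite !inE => /andP[-> /andP[/andP[-> _] _]].
  by rewrite andbT.
rewrite (_ : [set t in _ | _] = set0) ?cards0 ?expr0n //.
apply/setP => t; rewrite inE in_set0; apply/negP => /andP[].
rewrite mem_triangles => /andP[_ /subsetP tG].
by move=> /(subsetP (early_edges_sub _ _))/tG; rewrite eG.
Qed.

(* Noise enters the variance as N_e^2 Pr[e is light] <= K rho N_e. *)
Lemma expected_sq_error :
  \sum_O D O * mean p (sq_error O) <= T / p ^+ 2 + 3 * K * rho * T / p.
Proof.
have /andP[p0 _] := p01.
have le1 : \sum_O D O * mean p (sq_error O) <=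
    \sum_O D O * (T / p ^+ 2 +
      p^-1 * \sum_(e in edges G) (tri_count G e)%:R ^+ 2 * (~~ O e)%:R).
  by apply: ler_sum => O _; rewrite ler_wpM2l ?fdist_ge0 ?mean_sq_error.
apply: le_trans le1 _; under eq_bigr do rewrite mulrDr.
rewrite big_split /= -mulr_suml fdist_sum1 mul1r lerD2l.
under eq_bigr do rewrite mulrCA.
rewrite -mulr_sumr mulrC ler_wpM2r //; first by rewrite invr_ge0 ltW.
under eq_bigr do rewrite mulr_sumr.
rewrite exchange_big /=.
apply: (@le_trans _ _ (\sum_(e in edges G) K * rho * (tri_count G e)%:R)).
  apply: ler_sum => e eG; under eq_bigr do rewrite mulrCA.
  rewrite -mulr_sumr Pr_light; have [+ _] := noisyD eG.
  move: (tri_count G e)%:R (ler0n R (tri_count G e)) => N N0.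
  (* For an edge in no triangle the lower noise bound is void, but the factor [N ^+ 2] vanishes. *)
  case: ltgtP N0 => // [N0 _ /(_ isT) low|<- _ _]; last first.
    by rewrite expr0n mul0r mulr0.
  have : 1 - Pr D (fun O => O e) <= K * (rho / N) by lra.
  move=> /(ler_wpM2l (sqr_ge0 N)) /le_trans; apply.
  by rewrite le_eqVlt; apply/orP; left; apply/eqP; field; rewrite gt_eqF.
rewrite -mulr_sumr; apply: (le_trans (ler_wpM2l _ sum_tri_count_le)).
  by rewrite mulr_ge0 // ltW.
by rewrite le_eqVlt; apply/orP; left; apply/eqP; ring.
Qed.

Lemma card_streamE (P : pred {set 'I_n}) :
  #|[set e in s | P e]|%:R = \sum_(e in edges G) (P e)%:R :> R.
Proof.
rewrite -sum1_card natr_sum big_mkcond [RHS]big_mkcond /=; apply: eq_bigr => e _.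
by rewrite inE mem_stream; case: (e \in edges G); case: (P e).
Qed.

(** Heavy edges are charged to the upper noise bound, summed over edges; each light edge is stored
    with probability [p]. *)
Lemma expected_storage :
  \sum_O D O * mean p (fun J => (storage O J)%:R) <= 3 * K * T / rho + p * m.
Proof.
have /andP[p0 p1] := p01.
apply: (@le_trans _ _ (\sum_O D O * (\sum_(e in edges G) (O e)%:R + p * m))).
  apply: ler_sum => O _; rewrite ler_wpM2l ?fdist_ge0 //.
  rewrite (eq_mean p (g := fun J => \sum_(e in edges G) (O e)%:R +
      \sum_(e in edges G) (~~ O e && (e \in J))%:R)); last first.
    by move=> J; rewrite natrD !card_streamE.
  rewrite meanD mean_cst mean_sum lerD2l /m -sum1_card natr_sum mulr_sumr.
  apply: ler_sum => e _; rewrite mulr1 -[leRHS](mean_mem p e).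
  apply: le_mean; first by rewrite ltW.
  by move=> J; case: (O e); rewrite /= ?ler0n.
under eq_bigr do rewrite mulrDr.
rewrite big_split /= -mulr_suml fdist_sum1 mul1r lerD2r.
under eq_bigr do rewrite mulr_sumr.
rewrite exchange_big /=.
apply: (@le_trans _ _ (\sum_(e in edges G) K / rho * (tri_count G e)%:R)).
  apply: ler_sum => e eG; rewrite -PrE; have [_ up] := noisyD eG.
  by apply: le_trans up _; rewrite mulrAC mulrA.
rewrite -mulr_sumr; apply: (le_trans (ler_wpM2l _ sum_tri_count_le)).
  by rewrite mulr_ge0 // invr_ge0 ltW.
by rewrite le_eqVlt; apply/orP; left; apply/eqP; ring.
Qed.

Variables (S w B : nat).

(* Chebyshev and Markov at once, through a pointwise bound on the indicator of
   success. *)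
Lemma output_prob_ge (hp : 0 <= p <= 1) (eps : R) :
  (size (states n p B) <= 2 ^ (w * S))%N -> 0 < eps -> 0 < T ->
  1 - (\sum_O D O * mean p (sq_error O)) / (eps * T) ^+ 2
    - (\sum_O D O * mean p (fun J => (storage O J)%:R)) / B.+1%:R <=
  output_prob (@triangle_alg R n p S w B hp) D s (fun l => `|l - T| <= eps * T).
Proof.
move=> le eps0 T0; rewrite output_prob_coin_alg ?stream_uniq //.
rewrite -[X in X - _ - _](fdist_sum1 D) !mulr_suml -!sumrB; apply: ler_sum => O _.
set c := (eps * T) ^+ 2; set b : R := B.+1%:R.
have c0 : 0 < c by rewrite exprn_gt0 // mulr_gt0.
have b0 : 0 < b by rewrite ltr0n.
have -> : D O - D O * mean p (sq_error O) / c -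
    D O * mean p (fun J => (storage O J)%:R) / b =
    D O * mean p (fun J => 1 + (- c^-1 * sq_error O J +
                                - b^-1 * (storage O J)%:R)).
  by rewrite !meanD !meanZ mean_cst; ring.
rewrite ler_wpM2l ?fdist_ge0 //; apply: le_mean => // J.
rewrite !mulNr; set x := c^-1 * _; set y := b^-1 * _.
have x0 : 0 <= x by rewrite mulr_ge0 ?invr_ge0 ?sqr_ge0 // ltW.
have y0 : 0 <= y by rewrite mulr_ge0 // invr_ge0 ltW.
(* On overflow the storage is at least [B.+1], so the storage term alone makes the lower bound
   nonpositive. *)
have [big|small] := ltnP B (storage O J).
  have y1 : 1 <= y by rewrite /y mulrC ler_pdivlMr // mul1r ler_nat.
  apply: (@le_trans _ _ 0); last exact: ler0n.
  by move: x y x0 y0 y1 => x y x0 y0 y1; lra.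
rewrite (memory_run sG) //; last 2 first.
- exact: leq_trans (leq_addr _ _) small.
- exact: leq_trans (leq_addl _ _) small.
(* Without overflow the output is the true estimate, and a large deviation makes the error term at
   least 1. *)
have [_|far] := lerP `|(state_after p O J s).2 - T| (eps * T) => /=.
  by move: x y x0 y0 => x y x0 y0; lra.
suff x1 : 1 <= x by move: x y x0 y0 x1 => x y x0 y0 x1; lra.
rewrite /x mulrC ler_pdivlMr // mul1r /c /sq_error -[leRHS]real_normK ?num_real //.
by rewrite lerXn2r ?nnegrE ?normr_ge0 ?mulr_ge0 // ltW.
Qed.

End Accuracy.

(** * Choice of parameters and the resulting numerical bounds *)

Section Tuning.
Variables (R : realType) (K kappa : R).
Hypotheses (hK : 1 <= K) (hkappa : 1 <= kappa).

Definition threshold (m : nat) (eps tau : R) : R := eps * tau / Num.sqrt m%:R.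

(** The first summand controls the variance term [T / p ^+ 2], the second the noise term
    [3 * K * rho * T / p]. *)
Definition rate (m : nat) (eps tau : R) : R :=
  eps^-1 * (4 * kappa / Num.sqrt tau + 36 * K * kappa / Num.sqrt m%:R).

(* Outside the range of the theorem rate may be negative or exceed 1. *)
Definition sampling_prob m eps tau : R := Num.min 1 `|rate m eps tau|.

Lemma sampling_prob_bounds m eps tau : 0 <= sampling_prob m eps tau <= 1.
Proof. by rewrite le_min ler01 normr_ge0 ge_min lexx. Qed.

(** Bounds the expected storage using only known quantities: [T <= kappa * tau] removes [T] from
    [3 * K * T / rho]. *)
Definition mean_storage (m : nat) (eps tau : R) : R :=
  3 * K * kappa * Num.sqrt m%:R / eps + rate m eps tau * m%:R.

Definition capacity (m : nat) (eps tau : R) : nat :=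
  Num.truncn (6 * mean_storage m eps tau).

Variables (m T : nat) (eps tau : R).
Hypotheses (m_gt0 : (0 < m)%N) (T_gt0 : (0 < T)%N) (eps0 : 0 < eps) (eps1 : eps < 1).
Hypotheses (tau_ge : T%:R / kappa <= tau) (tau_le : tau <= kappa * T%:R).

Let kappa0 : 0 < kappa. Proof. exact: lt_le_trans hkappa. Qed.
Let K0 : 0 < K. Proof. exact: lt_le_trans hK. Qed.
Let T0 : 0 < T%:R :> R. Proof. by rewrite ltr0n. Qed.
Let tau0 : 0 < tau. Proof. by apply: lt_le_trans tau_ge; rewrite divr_gt0. Qed.
Let sm0 : 0 < Num.sqrt m%:R :> R. Proof. by rewrite sqrtr_gt0 ltr0n. Qed.
Let stau0 : 0 < Num.sqrt tau. Proof. by rewrite sqrtr_gt0. Qed.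
Let sT0 : 0 < Num.sqrt T%:R :> R. Proof. by rewrite sqrtr_gt0. Qed.
Let smE : m%:R = Num.sqrt m%:R ^+ 2 :> R. Proof. by rewrite sqr_sqrtr. Qed.

Lemma threshold_gt0 : 0 < threshold m eps tau.
Proof. by rewrite divr_gt0 // mulr_gt0. Qed.

Lemma rate_gt0 : 0 < rate m eps tau.
Proof.
by rewrite mulr_gt0 ?invr_gt0 // addr_gt0 // divr_gt0 // !mulr_gt0.
Qed.

Lemma sampling_probE :
  sampling_prob m eps tau = 1 \/ sampling_prob m eps tau = rate m eps tau.
Proof.
rewrite /sampling_prob (ger0_norm (ltW rate_gt0)).
by case: (leP 1 (rate m eps tau)) => h; [left|right].
Qed.

Lemma sampling_prob_gt0 : 0 < sampling_prob m eps tau.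
Proof. by case: sampling_probE => ->; rewrite ?rate_gt0. Qed.

Lemma mean_storage_ge0 : 0 <= mean_storage m eps tau.
Proof.
apply: ltW; rewrite /mean_storage addr_gt0 //.
  by rewrite divr_gt0 // !mulr_gt0.
by rewrite mulr_gt0 ?rate_gt0 // ltr0n.
Qed.

(** With [39 = 3 + 36], the factor [12 = 2 * 6] turns the coefficients 4 and 39 of the mean storage
    into 48 and 468; the second [kappa] beside 48 comes from replacing [tau] by [T]. *)
Lemma space_bound :
  (2 * capacity m eps tau + 1)%:R <=
  (48 * kappa ^+ 2 + 468 * K * kappa + 1) *
    (eps^-1 * (m%:R / Num.sqrt T%:R + Num.sqrt m%:R)).
Proof.
have cap : (capacity m eps tau)%:R <= 6 * mean_storage m eps tau.
  have := truncn_itv (mulr_ge0 (ler0n R 6) mean_storage_ge0).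
  by rewrite -/(capacity _ _ _) => /andP[].
have r1 : 1 <= Num.sqrt m%:R :> R.
  by rewrite -[X in X <= _]sqrtr1 ler_wsqrtr // ler1n.
have e1 : 1 <= eps^-1 by rewrite invf_ge1 // ltW.
have uq : Num.sqrt T%:R <= kappa * Num.sqrt tau.
  have -> : kappa * Num.sqrt tau = Num.sqrt (kappa ^+ 2 * tau).
    by rewrite sqrtrM ?sqr_ge0 // sqrtr_sqr ger0_norm // ltW.
  apply: ler_wsqrtr; move: tau_ge; rewrite ler_pdivrMr // => tg.
  apply: (le_trans tg); rewrite mulrC ler_pM2r // expr2 ler_peMl //.
  exact: ltW.
have mq : m%:R / Num.sqrt tau <= kappa * (m%:R / Num.sqrt T%:R).
  rewrite mulrCA ler_wpM2l // ler_pdivlMr // mulrC ler_pdivrMr //.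
have ma0 : 0 <= m%:R / Num.sqrt T%:R :> R by rewrite divr_ge0 // ltW.
have -> : (48 * kappa ^+ 2 + 468 * K * kappa + 1) *
    (eps^-1 * (m%:R / Num.sqrt T%:R + Num.sqrt m%:R)) =
  eps^-1 * ((48 * kappa ^+ 2 + 468 * K * kappa + 1) *
    (m%:R / Num.sqrt T%:R + Num.sqrt m%:R)) by ring.
have msE : mean_storage m eps tau =
    eps^-1 * (4 * kappa * (m%:R / Num.sqrt tau) + 39 * K * kappa * Num.sqrt m%:R).
  rewrite /mean_storage /rate; move: (Num.sqrt m%:R) smE sm0 => r -> r0.
  by field; rewrite !gt_eqF.
rewrite natrD natrM.
apply: (@le_trans _ _ (eps^-1 * (12 * (4 * kappa * (m%:R / Num.sqrt tau) +
    39 * K * kappa * Num.sqrt m%:R) + Num.sqrt m%:R))).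
  (* This absorbs the one extra word. *)
  have : 1 <= eps^-1 * Num.sqrt m%:R by rewrite -[X in X <= _]mulr1 ler_pM.
  rewrite mulrDr; rewrite msE in cap; lra.
rewrite ler_wpM2l //; first by rewrite invr_ge0 ltW.
move: (Num.sqrt m%:R) (m%:R / Num.sqrt tau) (m%:R / Num.sqrt T%:R) mq r1 ma0.
move=> r a b ab r1 b0.
have h1 : kappa * a <= kappa * (kappa * b) by rewrite ler_wpM2l // ltW.
have h2 : 0 <= K * kappa * b by rewrite !mulr_ge0 // ltW.
have h3 : 0 <= kappa ^+ 2 * r by rewrite mulr_ge0 ?sqr_ge0 //; lra.
lra.
Qed.

(** Truncation leaves [capacity + 1] above six times the mean, so Markov loses at most 1/6. *)
Lemma storage_bound (x : R) :
  x <= 3 * K * T%:R / threshold m eps tau + sampling_prob m eps tau * m%:R ->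
  x / (capacity m eps tau).+1%:R <= 1 / 6.
Proof.
move=> hx; have := truncn_itv (mulr_ge0 (ler0n R 6) mean_storage_ge0).
rewrite -/(capacity _ _ _) => /andP[_ cap].
rewrite ler_pdivrMr ?ltr0n //.
suff : x <= mean_storage m eps tau by lra.
apply: le_trans hx _; apply: lerD.
  rewrite /threshold (_ : _ / _ = K * Num.sqrt m%:R / eps * (3 * (T%:R / tau)));
    last by field; rewrite !gt_eqF.
  rewrite (_ : _ * _ * kappa * _ / _ = K * Num.sqrt m%:R / eps * (3 * kappa));
    last by field; rewrite gt_eqF.
  rewrite ler_wpM2l ?divr_ge0 ?mulr_ge0 ?(ltW K0) ?(ltW sm0) ?(ltW eps0) //.
  rewrite ler_wpM2l // ler_pdivrMr // mulrC -ler_pdivrMr //.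
by rewrite ler_wpM2r // ge_min (ger0_norm (ltW rate_gt0)) lexx orbT.
Qed.

(** Below the cap, the variance and noise terms each take at most 1/12 of [(eps * T) ^+ 2]. *)
Lemma sq_error_bound (x : R) :
  (sampling_prob m eps tau = 1 -> x = 0) ->
  x <= T%:R / sampling_prob m eps tau ^+ 2 +
    3 * K * threshold m eps tau * T%:R / sampling_prob m eps tau ->
  x / (eps * T%:R) ^+ 2 <= 1 / 6.
Proof.
have := sampling_probE.
set p := sampling_prob _ _ _; move=> [p1|pE].
  by move=> /(_ p1) -> _; rewrite mul0r divr_ge0.
move=> _ hx.
have p0 : 0 < p by rewrite pE rate_gt0.
have q0 := stau0; have r0 := sm0.
(* Each of the next two bounds keeps one summand of [rate] and drops the other. *)
have pq : 4 * kappa <= p * eps * Num.sqrt tau.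
  rewrite pE /rate [leRHS](_ : _ = 4 * kappa +
      36 * K * kappa * Num.sqrt tau / Num.sqrt m%:R);
    last by field; rewrite !gt_eqF.
  by rewrite lerDl divr_ge0 ?mulr_ge0 ?(ltW K0) ?(ltW kappa0) ?(ltW q0) ?(ltW r0).
have pr : 36 * K * kappa <= p * eps * Num.sqrt m%:R.
  rewrite pE /rate [leRHS](_ : _ = 36 * K * kappa +
      4 * kappa * Num.sqrt m%:R / Num.sqrt tau);
    last by field; rewrite !gt_eqF.
  by rewrite lerDl divr_ge0 ?mulr_ge0 ?(ltW K0) ?(ltW kappa0) ?(ltW q0) ?(ltW r0).
have pT : 12 <= p ^+ 2 * eps ^+ 2 * T%:R.
  have : (4 * kappa) ^+ 2 <= (p * eps * Num.sqrt tau) ^+ 2.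
    by rewrite lerXn2r ?nnegrE ?mulr_ge0 ?(ltW kappa0) ?(ltW p0)
       ?(ltW eps0) ?(ltW q0).
  rewrite !exprMn sqr_sqrtr ?(ltW tau0) // => h.
  have : p ^+ 2 * eps ^+ 2 * tau <= p ^+ 2 * eps ^+ 2 * (kappa * T%:R).
    by apply: ler_wpM2l tau_le; rewrite mulr_ge0 ?sqr_ge0.
  move=> /(le_trans h) {}h.
  have : kappa * (16 * kappa) <= kappa * (p ^+ 2 * eps ^+ 2 * T%:R) by lra.
  by rewrite ler_pM2l //; apply: le_trans; move: hkappa; lra.
have A : T%:R / p ^+ 2 <= 1 / 12 * (eps * T%:R) ^+ 2.
  rewrite ler_pdivrMr ?exprn_gt0 //.
  have := ler_wpM2r (ltW T0) pT; lra.
have Bd : 3 * K * threshold m eps tau * T%:R / p <= 1 / 12 * (eps * T%:R) ^+ 2.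
  rewrite ler_pdivrMr // /threshold.
  rewrite [leLHS](_ : _ = 3 * K * eps * tau * T%:R / Num.sqrt m%:R); last first.
    by field; rewrite gt_eqF.
  rewrite ler_pdivrMr //.
  apply: (@le_trans _ _ (3 * K * eps * (kappa * T%:R) * T%:R)).
    by rewrite ler_pM2r // ler_pM2l // !mulr_gt0.
  have eT : 0 <= eps * T%:R ^+ 2 by rewrite mulr_ge0 ?sqr_ge0 ?ltW.
  have := ler_wpM2l eT pr; lra.
rewrite ler_pdivrMr ?exprn_gt0 ?mulr_gt0 //.
by apply: le_trans hx _; move: A Bd; lra.
Qed.

End Tuning.

(** * Assembling the algorithm and its guarantees *)

Theorem theoremC1 (R : realType) (K kappa : R) (hK : 1 <= K)
    (hkappa : 1 <= kappa) :
  exists (C : R) (c : nat)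
    (rho : nat -> nat -> R -> R -> R)
    (space : nat -> nat -> R -> R -> nat)
    (A : forall (n m : nat) (eps Tapx : R),
        stream_alg R n (space n m eps Tapx) (c * up_log 2 n)%N),
  forall (n : nat) (G : sgraph n) (eps Tapx : R),
    let m := #|edges G| in
    let T := #|triangles G| in
    0 < eps -> eps < 1 ->
    (0 < T)%N ->
    T%:R / kappa <= Tapx -> Tapx <= kappa * T%:R ->
    [/\ 0 < rho n m eps Tapx,
        (space n m eps Tapx)%:R <=
          C * (eps^-1 * (m%:R / Num.sqrt T%:R + Num.sqrt m%:R)) &
        forall (s : seq {set 'I_n}) (D : fdist R (labelling n)),
          edge_stream G s ->
          noisy G K (rho n m eps Tapx) D ->
          2%:R / 3%:R <=
            output_prob (A n m eps Tapx) D s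
              (fun l => `|l - T%:R| <= eps * T%:R)].
Proof.
exists (48 * kappa ^+ 2 + 468 * K * kappa + 1), 12%N,
  (fun _ => @threshold R),
  (fun _ m eps tau => (2 * capacity K kappa m eps tau + 1)%N),
  (fun n m eps tau => @triangle_alg R n _ _ _ (capacity K kappa m eps tau)
     (sampling_prob_bounds K kappa m eps tau)).
move=> n G eps tau m T eps0 eps1 T_gt0 tau_ge tau_le.
(* A single triangle already forces at least three vertices and three edges. *)
have [t tG] := card_gt0P T_gt0; have t3 := card_triangle tG.
have n1 : (1 < n)%N by have := max_card (mem t); rewrite t3 card_ord; lia.
have m_gt0 : (0 < m)%N.
  have := tG; rewrite mem_triangles => /andP[_ /subset_leq_card].
  by rewrite card_tri_edges // -/m; lia.
have T0 : 0 < T%:R :> R by rewrite ltr0n.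
have rho0 := threshold_gt0 hkappa m_gt0 T_gt0 eps0 tau_ge.
have p0 := sampling_prob_gt0 hK hkappa m_gt0 T_gt0 eps0 tau_ge.
split=> //; first exact: space_bound.
move=> s D sG noisyD.
set p := sampling_prob K kappa m eps tau in p0 *.
set B := capacity K kappa m eps tau.
have p01 : 0 < p <= 1.
  by rewrite p0; case/andP: (sampling_prob_bounds K kappa m eps tau).
(* Since [n <= 2 ^ up_log 2 n], words of [12 * up_log 2 n] bits hold the state number. *)
have size_ok : (size (states n p B) <= 2 ^ (12 * up_log 2 n * (2 * B + 1)))%N.
  apply: leq_trans (size_states p B n1) _.
  rewrite mulnAC (mulnC _ (up_log 2 n)) [leqRHS]expnM.
  by case: (12 * (2 * B + 1))%N => // k;
    rewrite leq_exp2r // up_logP.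
have K_ge0 : 0 <= K by apply: le_trans hK.
have ge := output_prob_ge D sG
  (sampling_prob_bounds K kappa m eps tau) size_ok eps0 T0.
apply: le_trans ge.
have st := storage_bound hK hkappa m_gt0 T_gt0 eps0 tau_ge
  (expected_storage K_ge0 rho0 p01 sG noisyD).
have exact_case : p = 1 -> \sum_O D O * mean p (sq_error G p s O) = 0.
  move=> p1; rewrite big1 // => O _.
  by rewrite (mean_sq_error_exact p01 sG) ?mulr0.
have sq := sq_error_bound hK hkappa m_gt0 T_gt0 eps0 tau_ge tau_le exact_case
  (expected_sq_error K_ge0 rho0 p01 sG noisyD).
(* Error and overflow cost 1/6 each, leaving 2/3. *)
by apply: le_trans (lerB (lerB (lexx 1) sq) st); lra.
Qed.
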